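(* Let $(\omega(t),g(t))$ be the left-invariant Chern-Ricci flow solution starting at a left-invariant hermitian structure $(\omega_0,g_0)$ on a Lie group with Lie algebra $\mathfrak g$ of dimension $2n$, with maximal interval of existence $(T_-,T_+)$, and let $P(t)$ be its Chern-Ricci operator. If $T_+<\infty$ (resp. $T_->-\infty$), then $$\int_0^{T_+}\mathrm{tr}\,P(t)\,dt=\infty\qquad\left(\text{resp. }\int_{T_-}^0\mathrm{tr}\,P(t)\,dt=-\infty\right).$$ Moreover, if $T_+<\infty$, then there is a constant $C>0$ such that $\mathrm{tr}\,P(t)\le\dfrac{C}{T_+-t}$ for all $t\in[0,T_+)$.
   Context: A left-invariant hermitian structure on a Lie group with Lie algebra $\mathfrak g$, $\dim\mathfrak g=2n$, is identified with a pair $(\omega,g)$, with $\omega$ a non-degenerate $2$-form and $g$ an inner product on $\mathfrak g$ such that $J$ defined by $\omega=g(J\cdot,\cdot)$ satisfies $J^2=-I$ and $[JX,JY]-[X,Y]-J[JX,Y]-J[X,JY]=0$ for all $X,Y\in\mathfrak g$. Its Chern-Ricci form is $$p(X,Y)=-\tfrac12\mathrm{tr}(J\,\mathrm{ad}[X,Y])+\tfrac12\mathrm{tr}(\mathrm{ad}(J[X,Y])),\qquad X,Y\in\mathfrak g,$$ which is a $(1,1)$-form since $J$ is integrable, and its Chern-Ricci operator $P\in\mathrm{End}(\mathfrak g)$ is defined by $p=\omega(P\cdot,\cdot)$; $\mathrm{tr}\,P$ is the Chern scalar curvature. The Chern-Ricci flow is $\frac{d}{dt}\omega=-2p$, equivalently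 $\frac{d}{dt}g=-2p(\cdot,J\cdot)$, for hermitian structures $(\omega(t),g(t))$ on $\mathfrak g$ (with $J$ fixed); $P(t)$ is the Chern-Ricci operator of $(\omega(t),g(t))$. *)

(* Defs.v *)
From HB Require Import structures.
From mathcomp Require Import all_boot all_order all_algebra.
From mathcomp Require Import all_classical all_reals all_analysis.

Set Implicit Arguments.
Unset Strict Implicit.
Unset Printing Implicit Defensive.

Import Order.TTheory GRing.Theory Num.Theory.
Import numFieldNormedType.Exports.

Local Open Scope classical_set_scope.
Local Open Scope ring_scope.

(* Left-invariant structures on a Lie group are encoded by their values on its
   Lie algebra: a finite-dimensional real vector space V with a bracket br. *)
Definition lie_bracket (R : realType) (V : vectType R)
    (br : {bilinear V -> V -> V}) : Prop :=
  (forall x, br x x = 0) /\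
  (forall x y z, br x (br y z) + br y (br z x) + br z (br x y) = 0).

Definition ad (R : realType) (V : vectType R)
    (br : {bilinear V -> V -> V}) (x : V) : 'End(V) := linfun (br x).

(* The value does not depend on the chosen basis vbasis {:V}. *)
Definition end_tr (R : realType) (V : vectType R) (f : 'End(V)) : R :=
  \tr (passmx.mxof (vbasis {:V}) (vbasis {:V}) f).

Definition inner_product (R : realType) (V : vectType R)
    (g : {biscalar V}) : Prop :=
  (forall x y, g x y = g y x) /\ (forall x, x != 0 -> 0 < g x x).

Definition nondegenerate_2form (R : realType) (V : vectType R)
    (w : {biscalar V}) : Prop :=
  (forall x, w x x = 0) /\ (forall x, (forall y, w x y = 0) -> x = 0).

(* J is an argument, but it is determined by (w, g) through herm_cplx. *)
Record hermitian_structure (R : realType) (V : vectType R)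
    (br : {bilinear V -> V -> V}) (J : 'End(V)) (w g : {biscalar V}) : Prop :=
  HermitianStructure {
    herm_form : nondegenerate_2form w;
    herm_metric : inner_product g;
    herm_cplx : forall x y, w x y = g (J x) y;
    herm_sqr : forall x, J (J x) = - x;
    herm_integrable : forall x y,
      br (J x) (J y) - br x y - J (br (J x) y) - J (br x (J y)) = 0 }.

Definition chern_ricci_form (R : realType) (V : vectType R)
    (br : {bilinear V -> V -> V}) (J : 'End(V)) (x y : V) : R :=
  - 2^-1 * end_tr (J \o ad br (br x y))%VF + 2^-1 * end_tr (ad br (J (br x y))).

(* Since w is nondegenerate, this determines P. *)
Definition chern_ricci_operator (R : realType) (V : vectType R)
    (br : {bilinear V -> V -> V}) (J : 'End(V)) (w : {biscalar V})
    (P : 'End(V)) : Prop :=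
  forall x y, chern_ricci_form br J x y = w (P x) y.

(* Solutions on the open interval (a, b), with a, b possibly infinite.  As V is
   finite-dimensional, the derivative of t |-> w t is taken entrywise.  The
   values of w and g outside (a, b) are irrelevant. *)
Record chern_ricci_flow (R : realType) (V : vectType R)
    (br : {bilinear V -> V -> V}) (J : 'End(V)) (w0 g0 : {biscalar V})
    (a b : \bar R) (w g : R -> {biscalar V}) : Prop :=
  ChernRicciFlow {
    crf_left : (a < 0)%E;
    crf_right : (0 < b)%E;
    crf_form0 : w 0 =2 w0;
    crf_metric0 : g 0 =2 g0;
    crf_hermitian : forall t : R, (a < t%:E < b)%E ->
      hermitian_structure br J (w t) (g t);
    crf_flow : forall (t : R) (x y : V), (a < t%:E < b)%E ->
      is_derive t 1 (fun s : R => w s x y) (- 2 * chern_ricci_form br J x y) }.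

(* (a, b) is the maximal interval of existence: the solution has no extension
   to a strictly larger open interval. *)
Definition maximal_chern_ricci_flow (R : realType) (V : vectType R)
    (br : {bilinear V -> V -> V}) (J : 'End(V)) (w0 g0 : {biscalar V})
    (a b : \bar R) (w g : R -> {biscalar V}) : Prop :=
  chern_ricci_flow br J w0 g0 a b w g /\
  forall (a' b' : \bar R) (w' g' : R -> {biscalar V}),
    chern_ricci_flow br J w0 g0 a' b' w' g' ->
    (a' <= a)%E -> (b <= b')%E ->
    (forall t : R, (a < t%:E < b)%E -> w' t =2 w t /\ g' t =2 g t) ->
    a' = a /\ b' = b.

(* The Lebesgue integral of f over D exists in [-oo, +oo] and equals l.  The
   second clause excludes the undefined case oo - oo, in which the library's
   integral takes the value -oo. *)
Definition has_integral (R : realType) (D : set R) (f : R -> R)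
    (l : \bar R) : Prop :=
  let mu := @lebesgue_measure R in
  let F := fun t : R => (f t)%:E in
  [/\ measurable_fun D f,
      (\int[mu]_(t in D) F^\+%E t +? - \int[mu]_(t in D) F^\-%E t)%E
    & (\int[mu]_(t in D) F t)%E = l].

(* Main.v *)
Require Import Defs.
From HB Require Import structures.
From mathcomp Require Import all_boot all_order all_algebra.
From mathcomp Require Import all_classical all_reals all_analysis.
From mathcomp Require Import measurable_realfun.
From mathcomp Require Import ring lra.

Set Implicit Arguments.
Unset Strict Implicit.
Unset Printing Implicit Defensive.

Import Order.TTheory GRing.Theory Num.Theory.
Import numFieldNormedType.Exports.

Local Open Scope classical_set_scope.
Local Open Scope ring_scope.

(* Since p does not depend on the metric, the flow is the straight line
   omega(t) = omega_0 - 2 t p = omega_0((I - 2 t P(0)) ., .), and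
   P(t) = P(0) (I - 2 t P(0))^-1.  With D(t) = det (I - 2 t P(0)), Jacobi's
   formula gives tr P(t) = - D'(t) / (2 D(t)), so that the integral of tr P
   from 0 to t is - ln (D(t)) / 2.  Here D(0) = 1, and D is positive on
   (T_-, T_+) because omega(t) is nondegenerate there.  At a finite end T of the
   maximal interval, D(T) = 0: otherwise the limit of g(t) is semidefinite and
   nondegenerate, hence positive definite, this persists near T by
   Cauchy-Schwarz, and the line extends the flow.  So the integral diverges.
   Writing D(t) = (t - T)^m q(t) with q nonzero on the closed interval,
   D' / D = m / (t - T) + q' / q with q' / q bounded, which gives both the bound
   C / (T_+ - t) and the one-sided boundedness of tr P that keeps its integral
   from being oo - oo. *)

(** * Jacobi's formula *)

Lemma deriv_prod (R : comNzRingType) (I : eqType) (r : seq I)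
    (F : I -> {poly R}) : uniq r ->
  (\prod_(i <- r) F i)^`() =
  \sum_(i <- r) (F i)^`() * \prod_(j <- r | j != i) F j.
Proof.
elim: r => [_|x r IH /= /andP[xr ur]]; first by rewrite !big_nil derivC.
rewrite !big_cons eqxx /= derivM IH // mulr_sumr; congr (_ * _ + _).
  rewrite big_seq [in RHS]big_seq_cond; apply: eq_bigl => j.
  by case: eqP => [->|]; rewrite ?(negPf xr) // andbT.
rewrite [LHS]big_seq [RHS]big_seq; apply: eq_bigr => i ir; rewrite big_cons.
by case: eqP ir xr => [-> ->//|_ _ _]; rewrite mulrCA.
Qed.

(** Both sides are the sum over [j] of the determinant of [N j], in which row [j] of [M] is
    differentiated: on the left by the Leibniz formula and the product rule, on the right by
    expansion along row [j], whose cofactors are those of [M]. *)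
Lemma deriv_det (R : comNzRingType) n (M : 'M[{poly R}]_n) :
  (\det M)^`() = \tr (\adj M *m map_mx (@deriv R) M).
Proof.
pose N j := \matrix_(k, l) if k == j then (M k l)^`() else M k l.
have -> : \tr (\adj M *m map_mx (@deriv R) M) = \sum_j \det (N j).
  rewrite /mxtrace; under eq_bigr do rewrite mxE.
  rewrite exchange_big /=; apply: eq_bigr => j _.
  rewrite (expand_det_row _ j); apply: eq_bigr => l _.
  rewrite !mxE eqxx mulrC; congr (_ * (_ * \det _)).
  by apply/matrixP => a b; rewrite !mxE eq_sym (negPf (neq_lift _ _)).
rewrite {1}/determinant linear_sum [RHS]exchange_big /=; apply: eq_bigr => s _.
have -> (b : bool) (p : {poly R}) : ((-1) ^+ b * p)^`() = (-1) ^+ b * p^`().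
  by case: b; rewrite ?expr0 ?expr1 ?mul1r ?mulN1r ?derivN.
rewrite deriv_prod ?index_enum_uniq // mulr_sumr; apply: eq_bigr => j _.
rewrite [in RHS](bigD1 j) //= mxE eqxx; congr (_ * (_ * _)).
by apply: eq_bigr => k kj; rewrite mxE (negPf kj).
Qed.

(** The reversed characteristic polynomial of [A]. *)
Definition det_pencil (R : comNzRingType) n (A : 'M[R]_n) : {poly R} :=
  \det (1%:M - 'X *: map_mx polyC A).

Lemma horner_det_pencil (R : comNzRingType) n (A : 'M[R]_n) t :
  (det_pencil A).[t] = \det (1%:M - t *: A).
Proof.
rewrite -[LHS]/(horner_eval t (det_pencil A)) -det_map_mx; congr (\det _).
apply/matrixP => i j; rewrite !mxE -[LHS]/(_.[t]) !(hornerMn, hornerE) //.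
Qed.

(** With [M = 1 - t A] and [A = B M], cyclicity of the trace gives [tr (adj M A) = tr (B M adj M) =
    tr B det M]. The hypothesis expresses [B = A M^-1] without forming an inverse. *)
Lemma deriv_det_pencil (R : comUnitRingType) n (A B : 'M[R]_n) t :
  B *m (1%:M - t *: A) = A ->
  (det_pencil A)^`().[t] = - (\tr B * (det_pencil A).[t]).
Proof.
move=> BA; rewrite horner_det_pencil deriv_det.
set M := 1%:M - t *: A in BA *.
set N := 1%:M - 'X *: map_mx polyC A.
have NM : map_mx (horner_eval t) N = M.
  apply/matrixP => i j; rewrite !mxE -[LHS]/(_.[t]) !(hornerMn, hornerE) //.
have dN : map_mx (horner_eval t) (map_mx (@deriv R) N) = - A.
  apply/matrixP => i j; rewrite !mxE -[LHS]/(_.[t]).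
  rewrite derivB derivMn derivC mul0rn.
  by rewrite derivM derivX derivC !hornerE.
rewrite -[LHS]/(horner_eval t _) raddf_sum /=.
under eq_bigr => i _.
  rewrite mxE raddf_sum /=.
  under eq_bigr do rewrite rmorphM /=.
  over.
have -> : \sum_(i < n) \sum_(j < n) horner_eval t ((\adj N) i j) *
    horner_eval t (map_mx (@deriv R) N j i) = \tr (\adj M *m - A).
  rewrite -NM -dN -map_mx_adj; apply: eq_bigr => i _; rewrite mxE.
  by apply: eq_bigr => j _; rewrite !mxE.
rewrite mulmxN raddfN /=; congr (- _).
by rewrite -[in LHS]BA mxtrace_mulC -mulmxA mul_mx_adj mul_mx_scalar mxtraceZ
  mulrC.
Qed.

(** * Logarithmic derivatives of polynomials *)

(** Factoring [p = q (X - T)^m] with [q.[T]] nonzero, the difference is [q' / q], which is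
    continuous on the compact interval [[a, b]]. *)
Lemma poly_logderiv_bound (R : realType) (p : {poly R}) (T a b : R) :
  (forall t, a <= t <= b -> t != T -> p.[t] != 0) -> p.[T] = 0 -> p != 0 ->
  exists m K : R, [/\ 0 <= m, 0 <= K & forall t, a <= t <= b -> t != T ->
    `|p^`().[t] / p.[t] - m / (t - T)| <= K].
Proof.
move=> p0 pT pn0; have [m [q]] := multiplicity_XsubC p T.
rewrite pn0 /= => qT pE.
have q0 t : a <= t <= b -> q.[t] != 0.
  move=> tab; have [->//|tT] := eqVneq t T.
  by have := p0 t tab tT; rewrite pE hornerM mulf_eq0 negb_or => /andP[].
have : bounded_set ((fun t => q^`().[t] / q.[t]) @` `[a, b]).
  apply: compact_bounded; apply: continuous_compact; last exact: segment_compact.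
  apply: continuous_in_subspaceT => t; rewrite inE /= in_itv /= => tab.
  by apply: cvgM; [|apply: cvgV; first exact: q0]; exact: continuous_horner.
(* Boundedness provides a bound by every number strictly above [K0]; this one is also
   nonnegative. *)
case=> K0 [_ bK]; pose K := `|K0| + 1.
exists m%:R, K; split; rewrite ?ler0n // ?addr_ge0 // => t tab tT.
have -> : p^`().[t] / p.[t] - m%:R / (t - T) = q^`().[t] / q.[t].
  have tT0 : t - T != 0 by rewrite subr_eq0.
  have qt0 := q0 _ tab.
  rewrite pE derivM deriv_exp derivXsubC mul1r !(hornerE, horner_exp, hornerMn).
  (* The derivative of the power has the truncated exponent [m.-1], so [m = 0] is treated apart. *)
  case: m {pE} => [|m] /=; first by rewrite mulr0n !expr0; field; rewrite qt0.
  rewrite exprS -mulr_natl.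
  field; rewrite qt0 tT0 expf_neq0 //=.
apply: (bK K); first by rewrite /K (le_lt_trans (ler_norm K0)) // ltrDl.
by exists t => //=; rewrite in_itv.
Qed.

Lemma integral_poly_logderiv (R : realType) (p : {poly R}) (c a b : R) :
  a < b -> (forall t, a <= t <= b -> 0 < p.[t]) ->
  (\int[@lebesgue_measure R]_(t in `[a, b]) (c * (p^`().[t] / p.[t]))%:E =
   (c * (ln p.[b] - ln p.[a]))%:E)%E.
Proof.
move=> ab p0.
have dF t : a <= t <= b ->
    is_derive t 1 (fun s => c * ln p.[s]) (c * (p^`().[t] / p.[t])).
  move=> tab.
  have dp : is_derive t 1 (fun s => p.[s]) p^`().[t].
    apply: DeriveDef; first exact: derivable_horner.
    by rewrite -derive1E -derivE.
  have dln := is_derive1_ln (p0 t tab).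
  have := is_deriveZ c (is_derive1_comp dln dp).
  by rewrite [_^-1 * _]mulrC.
have cF t : a <= t <= b -> {for t, continuous (fun s => c * ln p.[s])}.
  move=> tab; apply: differentiable_continuous.
  by apply/derivable1_diffP; have [] := dF t tab.
rewrite (@continuous_FTC2 _ _ (fun s => c * ln p.[s])) //.
- by rewrite -EFinB mulrBr.
- apply: continuous_in_subspaceT => t; rewrite inE /= in_itv /= => tab.
  apply: cvgM; first exact: cvg_cst.
  by apply: cvgM; [|apply: cvgV; first by rewrite gt_eqF ?p0];
    exact: continuous_horner.
- split.
  + move=> t; rewrite in_itv /= => /andP[/ltW ta /ltW tb].
    by have [] := dF t; rewrite ?ta.
  + by apply: cvg_at_right_filter; apply: cF; rewrite lexx ltW.
  + by apply: cvg_at_left_filter; apply: cF; rewrite lexx ltW.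
- move=> t; rewrite in_itv /= => /andP[/ltW ta /ltW tb].
  by rewrite derive1E; have [_] := dF t (introT andP (conj ta tb)).
Qed.

(** * Integrals diverging to infinity *)

Lemma has_integral_pinfty (R : realType) (D : set R) (f : R -> R) (K : R) :
  measurable D -> (lebesgue_measure D < +oo)%E -> measurable_fun D f ->
  (forall t, D t -> - K <= f t) ->
  (forall M : R, exists2 A : set R, measurable A /\ A `<=` D &
    (M%:E <= \int[@lebesgue_measure R]_(t in A) (f t)%:E)%E) ->
  has_integral D f +oo%E.
Proof.
move=> mD Dfin mf fK fM.
pose F := fun t : R => (f t)%:E.
have mF : measurable_fun D F by exact/measurable_EFinP.
(* The negative part is at most [|K|] on a set of finite measure, which rules out [oo - oo]. *)
have negfin : (\int[@lebesgue_measure R]_(t in D) F^\-%E t < +oo)%E.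
  apply: (@le_lt_trans _ _
    (\int[@lebesgue_measure R]_(t in D) (cst `|K|%:E) t)%E); last first.
    by rewrite integral_cst // lte_mul_pinfty.
  apply: ge0_le_integral => //.
  - exact: measurable_funeneg.
  - move=> t Dt; rewrite funenegE ge_max -EFinN !lee_fin normr_ge0 andbT.
    by rewrite (le_trans _ (ler_norm K)) // lerNl fK.
have negfn : (\int[@lebesgue_measure R]_(t in D) F^\-%E t)%E \is a fin_num.
  by rewrite ge0_fin_numE // integral_ge0 // => t _; exact: funeneg_ge0.
(* The integral of the positive part over [D] dominates that of [f] over every test set [A], hence
   every real [M]. *)
have pos : (\int[@lebesgue_measure R]_(t in D) F^\+%E t = +oo)%E.
  apply/eqyP => M M0; have [A [mA AD] /le_trans] := fM M; apply.
  apply: (@le_trans _ _ (\int[@lebesgue_measure R]_(t in A) F^\+%E t)%E).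
    rewrite integralE geeDl // oppe_le0; apply: integral_ge0 => t _.
    exact: funeneg_ge0.
  by apply: ge0_subset_integral => //; exact: measurable_funepos.
rewrite /has_integral /= -/F; split => //.
  by rewrite pos; case: (\int[_]_(_ in _) _)%E negfn.
rewrite integralE -/F pos addye //.
by apply: contraTneq negfn => /(congr1 oppe); rewrite oppeK => ->.
Qed.

Lemma has_integralN (R : realType) (D : set R) (f : R -> R) (l : \bar R) :
  has_integral D f l -> has_integral D (fun t => - f t) (- l)%E.
Proof.
rewrite /has_integral /= => -[mf dint il]; split; first exact: measurable_funN.
  pose F := fun t : R => (f t)%:E.
  have -> : (fun t : R => (- f t)%:E) = (\- F)%E by [].
  by rewrite funeposN funenegN adde_defC -adde_defN.
by rewrite -il -integralN.
Qed.

Lemma has_integral_poly_logderiv_pinfty (R : realType) (p : {poly R})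
    (c K : R) (D : set R) (f : R -> R) :
  measurable D -> (lebesgue_measure D < +oo)%E ->
  (forall t, D t -> 0 < p.[t]) ->
  (forall t, D t -> f t = c * (p^`().[t] / p.[t])) ->
  (forall t, D t -> - K <= f t) ->
  (forall M : R, exists a b : R, [/\ a < b, `[a, b] `<=` D &
    M <= c * (ln p.[b] - ln p.[a])]) ->
  has_integral D f +oo%E.
Proof.
move=> mD Dfin p0 fE fK fM; apply: (has_integral_pinfty mD Dfin _ fK).
  apply: (eq_measurable_fun (fun t => c * (p^`().[t] / p.[t]))).
    by move=> t; rewrite inE => /fE.
  apply: subspace_continuous_measurable_fun => //.
  apply: continuous_in_subspaceT => t; rewrite inE => Dt.
  apply: cvgM; first exact: cvg_cst.
  by apply: cvgM; [|apply: cvgV; first by rewrite gt_eqF ?p0];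
    exact: continuous_horner.
move=> M; have [a [b [ab abD Mab]]] := fM M.
exists [set` `[a, b]%R]; first by split => //; exact: measurable_itv.
have -> : (\int[@lebesgue_measure R]_(t in `[a, b]) (f t)%:E =
    \int[@lebesgue_measure R]_(t in `[a, b]) (c * (p^`().[t] / p.[t]))%:E)%E.
  by apply: eq_integral => t /set_mem/abD/fE ->.
rewrite integral_poly_logderiv // => t tab.
by apply/p0/abD; rewrite /= in_itv.
Qed.

(** * Blow-up of the logarithmic derivative at a root *)

Lemma poly_lt_near_root (R : realType) (p : {poly R}) (T e : R) :
  p.[T] = 0 -> 0 < e ->
  exists2 d : R, 0 < d & forall s, `|T - s| < d -> p.[s] < e.
Proof.
move=> pT e0; have /cvgrPdist_lt/(_ e e0) := @continuous_horner R p T.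
rewrite pT => -[d /= d0 H]; exists d => // s /H /=.
by rewrite sub0r normrN; exact/le_lt_trans/ler_norm.
Qed.

Lemma logderiv_blowup_right (R : realType) (p : {poly R}) (T : R)
    (f : R -> R) :
  0 < T -> p.[T] = 0 -> (forall t, 0 <= t < T -> 0 < p.[t]) ->
  (forall t, 0 <= t < T -> f t = - 2^-1 * (p^`().[t] / p.[t])) ->
  has_integral `[0, T[ f +oo%E /\
  exists2 C : R, 0 < C & forall t : R, 0 <= t < T -> f t <= C / (T - t).
Proof.
move=> T0 pT p0 fE.
have pn0 : p != 0.
  apply: contraTneq (p0 0 (introT andP (conj (lexx 0) T0))) => ->.
  by rewrite horner0 ltxx.
have [|m [K [m0 K0 mK]]] := @poly_logderiv_bound R p T 0 T _ pT pn0.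
  move=> t /andP[t0]; rewrite le_eqVlt => /orP[/eqP->|tT _].
    by rewrite eqxx.
  by rewrite gt_eqF // p0 // t0.
(* This gives both the lower bound [- K / 2], as [m / (T - t)] is nonnegative, and the upper bound
   of order [1 / (T - t)]. *)
have bd t : 0 <= t < T -> `|f t - 2^-1 * (m / (T - t))| <= K / 2.
  move=> tT; have /andP[t0 lT] := tT.
  have /mK-/(_ _) : 0 <= t <= T by rewrite t0 ltW.
  rewrite fE // lt_eqF // => /(_ isT) H.
  have -> : - 2^-1 * (p^`().[t] / p.[t]) - 2^-1 * (m / (T - t)) =
     - 2^-1 * (p^`().[t] / p.[t] - m / (t - T)).
    by rewrite -[t - T]opprB invrN; ring.
  by rewrite normrM normrN (@ger0_norm _ 2^-1) ?invr_ge0 //; lra.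
split.
  apply: (@has_integral_poly_logderiv_pinfty R p (- 2^-1) (K / 2)) => //.
  - by rewrite lebesgue_measure_itv /= lte_fin T0 -EFinB ltry.
  - move=> t /=; rewrite in_itv /= => tT; have /andP[t0 lT] := tT.
    have := bd t tT; rewrite ler_norml => /andP[H _]; rewrite (le_trans H) //.
    by rewrite gerBl mulr_ge0 ?invr_ge0 // divr_ge0 // subr_ge0 ltW.
  - move=> M; have p00 : 0 < p.[0] by rewrite p0 // lexx.
    (* Below this threshold, [- (ln p.[s] - ln p.[0]) / 2] is at least [M]. *)
    have [|d d0 H] := @poly_lt_near_root R p T (expR (ln p.[0] - 2 * M)) pT.
      exact: expR_gt0.
    (* The minimum keeps [s] positive as well as within [d] of [T]. *)
    pose s := T - Num.min d T / 2.
    have m0' : 0 < Num.min d T by rewrite lt_min d0.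
    have md : Num.min d T <= d by rewrite ge_min lexx.
    have mT : Num.min d T <= T by rewrite ge_min lexx orbT.
    have s0 : 0 < s by rewrite /s; lra.
    have sT : s < T by rewrite /s; lra.
    exists 0, s; split => //.
      move=> t /=; rewrite !in_itv /= => /andP[-> ts] /=.
      exact: le_lt_trans ts sT.
    have ps : 0 < p.[s] by rewrite p0 // ltW.
    have : ln p.[s] <= ln p.[0] - 2 * M.
      rewrite -[leRHS]expRK ler_ln ?posrE ?expR_gt0 //; apply/ltW/H.
      by rewrite ger0_norm ?subr_ge0 ?ltW // /s; lra.
    by move=> ?; lra.
(* The bounded term [K / 2] is absorbed through [T - t <= T]; the [+ 1] makes the constant
   positive. *)
exists (m / 2 + (K + 1) * T).
  by rewrite ltr_wpDl ?divr_ge0 // mulr_gt0 // ltr_wpDl.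
move=> t tT; have /andP[t0 lT] := tT; have := bd t tT.
rewrite ler_norml => /andP[_]; rewrite lerBlDr => /le_trans; apply.
have Tt : 0 < T - t by rewrite subr_gt0.
rewrite mulrDl addrC [2^-1 * _]mulrCA mulrA lerD2l // ler_pdivlMr //.
by nra.
Qed.

(** Passing to [- f] reduces to divergence to [+oo]; to the right of [T] the term [m / (t - T)] is
    nonnegative, so [- f] is bounded below. *)
Lemma logderiv_blowup_left (R : realType) (p : {poly R}) (T : R)
    (f : R -> R) :
  T < 0 -> p.[T] = 0 -> (forall t, T < t <= 0 -> 0 < p.[t]) ->
  (forall t, T < t <= 0 -> f t = - 2^-1 * (p^`().[t] / p.[t])) ->
  has_integral `]T, 0] f -oo%E.
Proof.
move=> T0 pT p0 fE.
have -> : f = (fun t => - (- f t)) by apply/funext => t; rewrite opprK.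
apply: (@has_integralN R _ _ +oo%E).
have pn0 : p != 0.
  apply: contraTneq (p0 0 (introT andP (conj T0 (lexx 0)))) => ->.
  by rewrite horner0 ltxx.
have [|m [K [m0 K0 mK]]] := @poly_logderiv_bound R p T T 0 _ pT pn0.
  move=> t /andP[+ t0]; rewrite le_eqVlt => /orP[/eqP->|tT _].
    by rewrite eqxx.
  by rewrite gt_eqF // p0 // t0 tT.
apply: (@has_integral_poly_logderiv_pinfty R p 2^-1 (K / 2)) => //.
- by rewrite lebesgue_measure_itv /= lte_fin T0 -EFinB ltry.
- by move=> t /=; rewrite in_itv /= => /fE ->; rewrite mulNr opprK.
- move=> t /=; rewrite in_itv /= => tT; have /andP[Tt t0] := tT.
  have /mK-/(_ _) : T <= t <= 0 by rewrite t0 ltW.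
  rewrite gt_eqF // => /(_ isT); rewrite ler_norml => /andP[H _].
  have : 0 <= m / (t - T) by rewrite divr_ge0 // subr_ge0 ltW.
  by rewrite fE // => ?; lra.
- move=> M; have p00 : 0 < p.[0] by rewrite p0 // lexx T0.
  have [|d d0 H] := @poly_lt_near_root R p T (expR (ln p.[0] - 2 * M)) pT.
    exact: expR_gt0.
  pose s := T + Num.min d (- T) / 2.
  have m0' : 0 < Num.min d (- T) by rewrite lt_min d0 oppr_gt0.
  have md : Num.min d (- T) <= d by rewrite ge_min lexx.
  have mT : Num.min d (- T) <= - T by rewrite ge_min lexx orbT.
  have s0 : s < 0 by rewrite /s; lra.
  have sT : T < s by rewrite /s; lra.
  exists s, 0; split => //.
    move=> t /=; rewrite !in_itv /= => /andP[ts ->]; rewrite andbT.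
    exact: lt_le_trans sT ts.
  have ps : 0 < p.[s] by rewrite p0 // sT ltW.
  have : ln p.[s] <= ln p.[0] - 2 * M.
    rewrite -[leRHS]expRK ler_ln ?posrE ?expR_gt0 //; apply/ltW/H.
    by rewrite ltr0_norm ?subr_lt0 // /s; lra.
  by move=> ?; lra.
Qed.

(** * Bilinear forms *)

Section BilinearForms.
Variables (R : realType) (V : vectType R).

Section BiscalarLinear.
Variable g : {biscalar V}.

Lemma biscalarBl x y z : g (x - y) z = g x z - g y z.
Proof. by rewrite linearBl. Qed.

Lemma biscalarBr x y z : g z (x - y) = g z x - g z y.
Proof. exact: (linearB (g z)). Qed.

Lemma biscalarZl a x z : g (a *: x) z = a * g x z.
Proof. by rewrite linearZl_LR. Qed.

Lemma biscalarZr a x z : g z (a *: x) = a * g z x.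
Proof. exact: (linearZ_LR (g z) a). Qed.

Lemma biscalar0l z : g 0 z = 0.
Proof. by rewrite linear0l. Qed.

Lemma biscalar0r z : g z 0 = 0.
Proof. exact: (linear0 (g z)). Qed.

Lemma biscalar_suml n (F : 'I_n -> V) z : g (\sum_i F i) z = \sum_i g (F i) z.
Proof. exact: linear_sumlz. Qed.

Lemma biscalar_sumr n (F : 'I_n -> V) z : g z (\sum_i F i) = \sum_i g z (F i).
Proof. exact: (linear_sum (g z)). Qed.

End BiscalarLinear.

Definition form_comp (w : {biscalar V}) (f : 'End(V)) (x y : V) : R :=
  w (f x) y.

Lemma form_comp_bilinear (w : {biscalar V}) (f : 'End(V)) :
  bilinear_for *%R *%R (form_comp w f).
Proof.
split=> [y a u v|x a u v]; rewrite /form_comp.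
  by rewrite linearP linearPl.
by rewrite linearPr.
Qed.

HB.instance Definition _ (w : {biscalar V}) (f : 'End(V)) :=
  bilinear_isBilinear.Build R V V R *%R *%R (form_comp w f)
    (form_comp_bilinear w f).

Lemma cauchy_schwarz_semidef (g : {biscalar V}) :
  (forall x y, g x y = g y x) -> (forall x, 0 <= g x x) ->
  forall x y, g x y ^+ 2 <= g x x * g y y.
Proof.
move=> gC g0 x y.
have H s : 0 <= g x x - 2 * s * g x y + s ^+ 2 * g y y.
  have := g0 (x - s *: y).
  rewrite biscalarBl !biscalarBr !biscalarZl !biscalarZr (gC y x).
  by congr (0 <= _); ring.
have [y0|ny0] := eqVneq (g y y) 0; last first.
  have yp : 0 < g y y by rewrite lt_def ny0 g0.
  (* This parameter minimises the quadratic in [H]. *)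
  have := H (g x y / g y y).
  have -> : g x x - 2 * (g x y / g y y) * g x y + (g x y / g y y) ^+ 2 * g y y =
    (g x x * g y y - g x y ^+ 2) / g y y by field.
  by rewrite pmulr_lge0 ?invr_gt0 // subr_ge0.
rewrite y0 mulr0.
have [->//|nxy] := eqVneq (g x y) 0; first by rewrite expr0n.
(* When [g y y = 0] the expression in [H] is affine in [s], and this parameter gives it the value
   [-1]. *)
have := H ((g x x + 1) / (2 * g x y)).
have -> : 2 * ((g x x + 1) / (2 * g x y)) * g x y = g x x + 1 by field.
by rewrite y0 mulr0 => ?; lra.
Qed.

(** By Cauchy-Schwarz, a vector with [g x x = 0] lies in the kernel of [g]. *)
Lemma semidef_nondegenerate_pos (g : {biscalar V}) :
  (forall x y, g x y = g y x) -> (forall x, 0 <= g x x) ->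
  (forall x, (forall y, g x y = 0) -> x = 0) -> inner_product g.
Proof.
move=> gC g0 gn; split=> // x xn0; rewrite lt_def g0 andbT.
apply: contraNneq xn0 => gx; apply/eqP/gn => y; apply/eqP.
have := cauchy_schwarz_semidef gC g0 x y; rewrite gx mul0r => H.
by rewrite -sqrf_eq0 eq_le H sqr_ge0.
Qed.

(* The coordinate functionals are represented by vectors, through the inverse
   of the Gram matrix, so that Cauchy-Schwarz bounds them by the metric. *)
Lemma coord_bound (g : {biscalar V}) : inner_product g ->
  forall i, exists2 c : R, 0 <= c &
    forall x, coord (vbasis {:V}) i x ^+ 2 <= c * g x x.
Proof.
move=> [gC gp] i; pose e := vbasis {:V}.
have g0 x : 0 <= g x x.
  by have [->|/gp/ltW//] := eqVneq x 0; rewrite biscalar0r.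
pose M := \matrix_(i < \dim {:V}, j < \dim {:V}) g e`_i e`_j.
have gM x (j : 'I_(\dim {:V})) : g x e`_j = \sum_i coord e i x * M i j.
  rewrite {1}(coord_vbasis (memvf x)) biscalar_suml; apply: eq_bigr => k _.
  by rewrite biscalarZl mxE.
(* A null row vector of the Gram matrix gives an [x] orthogonal to the whole basis, hence to itself,
   so [x = 0]. *)
have Mu : M \in unitmx.
  rewrite unitmxE unitfE; apply/det0P => -[v vn0 vM].
  pose x := \sum_i v 0 i *: e`_i.
  have vx k : coord e k x = v 0 k.
    by rewrite coord_sum_free // (basis_free (vbasisP _)).
  have xe (j : 'I_(\dim {:V})) : g x e`_j = 0.
    rewrite gM; under eq_bigr do rewrite vx.
    by move/rowP/(_ j): vM; rewrite !mxE.
  have x0 : x = 0.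
    apply/eqP; apply: contraT => /gp; rewrite {2}(coord_vbasis (memvf x)).
    rewrite biscalar_sumr big1 ?ltxx // => k _.
    by rewrite biscalarZr /= xe mulr0.
  case/eqP: vn0; apply/rowP => k; rewrite mxE -vx x0 linear0 //.
pose u := \sum_j invmx M j i *: e`_j.
have gu x : coord e i x = g x u.
  rewrite biscalar_sumr /=; under eq_bigr do rewrite biscalarZr /= gM mulrC.
  have : (\row_k coord e k x *m M *m invmx M) 0 i = coord e i x.
    by rewrite -mulmxA mulmxV // mulmx1 mxE.
  rewrite mxE => <-; apply: eq_bigr => j _; rewrite mxE; congr (_ * _).
  by apply: eq_bigr => k _; rewrite mxE.
exists (g u u) => // x; rewrite gu mulrC.
exact: cauchy_schwarz_semidef.
Qed.

(** In coordinates, [|x_i x_j| <= (x_i^2 + x_j^2) / 2], and each square is bounded by the metric.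
    This makes positivity an open condition along the line, with an explicit radius. *)
Lemma form_bounded_by_metric (g h : {biscalar V}) : inner_product g ->
  exists2 C : R, 0 <= C & forall x, `|h x x| <= C * g x x.
Proof.
move=> ig; pose e := vbasis {:V}.
have /all_sig2[c c0 cb] : forall i, {c : R | 0 <= c &
    forall x, coord e i x ^+ 2 <= c * g x x}.
  by move=> i; apply: cid2; exact: coord_bound.
exists (\sum_(i < \dim {:V}) \sum_(j < \dim {:V})
  `|h e`_i e`_j| * ((c i + c j) / 2)).
  apply: sumr_ge0 => i _; apply: sumr_ge0 => j _.
  by rewrite mulr_ge0 // divr_ge0 // addr_ge0.
move=> x; rewrite {1 2}(coord_vbasis (memvf x)) biscalar_suml.
rewrite (le_trans (ler_norm_sum _ _ _)) // mulr_suml ler_sum // => i _.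
rewrite biscalar_sumr (le_trans (ler_norm_sum _ _ _)) // mulr_suml ler_sum // => j _.
rewrite biscalarZl biscalarZr /= -/e mulrCA mulrA !normrM -mulrA.
rewrite [leLHS]mulrA [leLHS]mulrC -mulrA ler_wpM2l //.
have H1 := cb i x; have H2 := cb j x.
rewrite -[coord e i x ^+ 2]real_normK ?num_real // in H1.
rewrite -[coord e j x ^+ 2]real_normK ?num_real // in H2.
have := sqr_ge0 (`|coord e i x| - `|coord e j x|).
by move=> ?; nra.
Qed.

End BilinearForms.

(** * Lines of hermitian structures *)

(** Carries the linear conditions on a hermitian structure from the parameters [0] and [s] to the
    whole line. *)
Lemma affine_eq0 (R : realFieldType) (a b s t : R) :
  s != 0 -> a = 0 -> a + s * b = 0 -> a + t * b = 0.
Proof.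
move=> s0 -> /eqP; rewrite !add0r mulf_eq0 (negPf s0) /= => /eqP ->.
by rewrite mulr0.
Qed.

Lemma is_derive0_segment (R : realType) (f : R -> R) (a b : R) : a <= b ->
  (forall t, a <= t <= b -> is_derive t 1 f 0) -> f a = f b.
Proof.
move=> ab df; have [||c _] := @MVT_segment R f (fun=> 0) a b ab.
- by move=> t; rewrite in_itv /= => /andP[/ltW ta /ltW tb]; apply: df; rewrite ta.
- apply: continuous_in_subspaceT => t; rewrite inE /= in_itv /= => /df[dt _].
  by apply: differentiable_continuous; apply/derivable1_diffP.
by rewrite mul0r => /eqP; rewrite subr_eq0 => /eqP.
Qed.

Section ChernRicciLine.
Variables (R : realType) (V : vectType R) (br : {bilinear V -> V -> V}).
Variables (J : 'End(V)) (w0 g0 : {biscalar V}) (P0 : 'End(V)).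
Hypothesis h0 : hermitian_structure br J w0 g0.
Hypothesis hP0 : chern_ricci_operator br J w0 P0.

Local Notation p := (chern_ricci_form br J).

Definition flow_map (t : R) : 'End(V) := (\1 - (2 * t) *: P0)%VF.

Definition form_line (t : R) : {biscalar V} := form_comp w0 (flow_map t).

(** Since [J^2 = -1], the relation [w = g (J ., .)] is inverted by [g = w (- J ., .)]. *)
Definition metric_line (t : R) : {biscalar V} := form_comp (form_line t) (- J).

(** The polynomial [D] with [D(t) = det (I - 2 t P(0))]; the factor 2 is absorbed into the
    matrix. *)
Definition flow_poly : {poly R} :=
  det_pencil (2 *: passmx.mxof (vbasis {:V}) (vbasis {:V}) P0).

Lemma flow_mapE t x : flow_map t x = x - (2 * t) *: (P0 x : V) :> V.
Proof. by rewrite /flow_map !lfunE /= !lfunE /= !lfunE. Qed.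

Lemma form_line_flow_map t x y : form_line t x y = w0 (flow_map t x) y.
Proof. by []. Qed.

Lemma form_lineE t x y : form_line t x y = w0 x y + t * (- 2 * p x y).
Proof.
rewrite form_line_flow_map flow_mapE.
by rewrite biscalarBl biscalarZl hP0; ring.
Qed.

Lemma metric_lineE t x y : metric_line t x y = form_line t (- J x) y.
Proof. by rewrite [LHS]/(form_line t ((- J)%VF x) y) lfunE. Qed.

Lemma hermitian_metricE w g x y :
  hermitian_structure br J w g -> g x y = w (- J x) y.
Proof.
case=> _ _ wg J2 _; have JJ : J (- J x) = x by rewrite linearN /= J2 opprK.
by rewrite wg JJ. Qed.

Lemma hermitian_eq2 (w g w' g' : {biscalar V}) :
  w =2 w' -> g =2 g' -> hermitian_structure br J w g ->
  hermitian_structure br J w' g'.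
Proof.
move=> ww gg [[wa wn] [gC gp] wg J2 Jint]; split=> //.
- split=> [x|x xw]; rewrite -?ww ?wa //.
  by apply: wn => y; rewrite ww.
- split=> [x y|x x0]; rewrite -!gg; [exact: gC|exact: gp].
- by move=> x y; rewrite -ww -gg.
Qed.

Lemma mxof_flow_map t : passmx.mxof (vbasis {:V}) (vbasis {:V}) (flow_map t) =
  1%:M - t *: (2 *: passmx.mxof (vbasis {:V}) (vbasis {:V}) P0).
Proof.
have b := vbasisP {:V}.
have -> : flow_map t = (- (2 * t)) *: P0 + \1%VF.
  by rewrite /flow_map scaleNr addrC.
rewrite passmx.mxof_linear passmx.mxof1 ?(basis_free b) //.
by rewrite scalerA addrC scaleNr [t * 2]mulrC.
Qed.

Lemma flow_poly_eq0 t :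
  reflect (exists2 x, x != 0 & flow_map t x = 0) (flow_poly.[t] == 0).
Proof.
have b := vbasisP {:V}.
rewrite /flow_poly horner_det_pencil -mxof_flow_map.
apply: (iffP det0P) => -[v v0 vM].
  exists (passmx.vecof (vbasis {:V}) v); first by rewrite passmx.vecof_eq0.
  by rewrite (passmx.hom_vecof _ b) vM; apply/eqP; rewrite passmx.vecof_eq0.
exists (passmx.rVof (vbasis {:V}) v); first by rewrite passmx.rVof_eq0.
by rewrite -(passmx.rVof_app _ b) vM; apply/eqP; rewrite passmx.rVof_eq0.
Qed.

Lemma flow_poly0 : flow_poly.[0] = 1.
Proof. by rewrite /flow_poly horner_det_pencil scale0r subr0 det1. Qed.

Lemma flow_poly_neq0 t g :
  hermitian_structure br J (form_line t) g -> flow_poly.[t] != 0.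
Proof.
move=> [[_ wn] _ _ _ _]; apply/negP => /flow_poly_eq0[x /eqP x0 Mx]; apply: x0.
by apply: wn => y; rewrite form_line_flow_map Mx biscalar0l.
Qed.

(** Nondegeneracy of [w0] turns [w0 (flow_map t (P x)) y = p x y = w0 (P0 x) y] into
    [flow_map t \o P = P0]. Matrices act on row vectors, so this is the hypothesis [B (1 - t A) = A]
    of Jacobi's formula for the pencil, with [A] and [B] the matrices of [2 P0] and [2 P]. *)
Lemma chern_scalar_logderiv t w P :
  hermitian_structure br J w (metric_line t) -> w =2 form_line t ->
  chern_ricci_operator br J w P ->
  end_tr P = - 2^-1 * (flow_poly^`().[t] / flow_poly.[t]).
Proof.
move=> hw wE hP; have b := vbasisP {:V}.
have D0 : flow_poly.[t] != 0.
  by apply: (@flow_poly_neq0 t (metric_line t)); exact: hermitian_eq2 hw.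
have MP : (flow_map t \o P)%VF = P0.
  apply/lfunP => x; rewrite lfunE /=; apply/eqP; rewrite -subr_eq0; apply/eqP.
  case: h0 => -[_ wn] _ _ _ _; apply: wn => y; rewrite biscalarBl.
  by rewrite -form_line_flow_map -wE -hP -hP0 subrr.
have := @deriv_det_pencil R _ (2 *: passmx.mxof (vbasis {:V}) (vbasis {:V}) P0)
  (2 *: passmx.mxof (vbasis {:V}) (vbasis {:V}) P) t.
rewrite -mxof_flow_map -scalemxAl -(passmx.mxof_comp _ _ b) MP => /(_ erefl).
rewrite -/flow_poly mxtraceZ -/(end_tr P) => ->.
by field.
Qed.

Lemma is_derive_form_line (t : R) x y :
  is_derive t 1 (fun s : R => form_line s x y) (- 2 * p x y).
Proof.
have -> : (fun s : R => form_line s x y) =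
    (cst (w0 x y) + (- 2 * p x y) \*: (@id R)).
  by apply/funext => s; rewrite form_lineE mulrC.
have := is_deriveD (is_derive_cst (w0 x y) t 1)
  (is_deriveZ (- 2 * p x y) (is_derive_id t 1)).
by rewrite add0r [_ *: 1]mulr1.
Qed.

(* Hermitian symmetry holds at the parameters 0 and s and is affine in t. *)
Lemma metric_line_symmetric s t : s != 0 ->
  hermitian_structure br J (form_line s) (metric_line s) ->
  forall x y, metric_line t x y = metric_line t y x.
Proof.
move=> s0 [_ [gC _] _ _ _] x y; apply/eqP; rewrite -subr_eq0; apply/eqP.
have E r : metric_line r x y - metric_line r y x =
    (g0 x y - g0 y x) + r * (- 2 * p (- J x) y + 2 * p (- J y) x).
  rewrite !metric_lineE !form_lineE !(hermitian_metricE _ _ h0).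
  by ring.
rewrite E; apply: (affine_eq0 (s := s)) => //.
  by case: h0 => _ [-> _] _ _ _; rewrite subrr.
by rewrite -E gC subrr.
Qed.

Lemma form_line_alternating s t : s != 0 ->
  hermitian_structure br J (form_line s) (metric_line s) ->
  forall x, form_line t x x = 0.
Proof.
move=> s0 [[wa _] _ _ _ _] x; rewrite form_lineE; apply: (affine_eq0 (s := s)) => //.
  by case: h0 => -[->].
by rewrite -form_lineE.
Qed.

(** Symmetry and alternation are affine in the parameter, so positivity is what remains to be
    supplied. It yields nondegeneracy: if [w_t (x, .) = 0], then
    [g_t (J x, J x) = w_t (x, J x) = 0]. *)
Lemma hermitian_line s t : s != 0 ->
  hermitian_structure br J (form_line s) (metric_line s) ->
  (forall x, x != 0 -> 0 < metric_line t x x) ->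
  hermitian_structure br J (form_line t) (metric_line t).
Proof.
move=> s0 hs gp; have J2 := herm_sqr h0.
split=> //; last exact: (herm_integrable h0).
- split=> [|x xw]; first exact: (form_line_alternating _ s0).
  have -> : x = - J (J x) by rewrite J2 opprK.
  apply/eqP; rewrite oppr_eq0; apply/eqP.
  suff -> : J x = 0 by rewrite linear0.
  apply/eqP; apply: contraT => /gp; rewrite metric_lineE J2 opprK xw ltxx //.
- by split=> //; exact: (metric_line_symmetric _ s0).
- by move=> x y; rewrite metric_lineE J2 opprK.
Qed.

(** The segment from [0] to [T] is written as [s * T], so that the lemma serves both ends of the
    interval. *)
Lemma hermitian_near_endpoint (T : R) : T != 0 ->
  (forall s, 0 <= s < 1 ->
    hermitian_structure br J (form_line (s * T)) (metric_line (s * T))) ->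
  flow_poly.[T] != 0 ->
  exists2 e : R, 0 < e & forall t, `|t - T| < e ->
    hermitian_structure br J (form_line t) (metric_line t).
Proof.
move=> T0 hs DT; pose s1 := 2^-1 * T.
have s10 : s1 != 0 by rewrite mulf_neq0 // invr_eq0 pnatr_eq0.
have h1 : hermitian_structure br J (form_line s1) (metric_line s1).
  by apply: hs; apply/andP; split; lra.
have mE r x : metric_line r x x = g0 x x + r * (- 2 * p (- J x) x).
  by rewrite metric_lineE form_lineE (hermitian_metricE _ _ h0).
(* If the value [d] at [T] were negative, the affine function [t |-> g_t (x, x)] would vanish at
   [s * T] with [s = g0 x x / (g0 x x - d)] in [[0, 1)], where the metric is positive. *)
have psd x : 0 <= metric_line T x x.
  have [->|x0] := eqVneq x 0; first by rewrite biscalar0r.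
  rewrite leNgt; apply/negP => neg.
  have a0 : 0 < g0 x x by case: h0 => _ [_ +] _ _ _; apply.
  pose d := metric_line T x x.
  have ad : 0 < g0 x x - d by rewrite subr_gt0 (lt_trans neg).
  pose s := g0 x x / (g0 x x - d).
  have s01 : 0 <= s < 1.
    by rewrite divr_ge0 ?ltW //= ltr_pdivrMr // mul1r ltrDl oppr_gt0.
  have := (herm_metric (hs s s01)).2 x x0; rewrite mE.
  suff -> : g0 x x + s * T * (- 2 * p (- J x) x) = 0 by rewrite ltxx.
  have -> : s * T * (- 2 * p (- J x) x) = s * (d - g0 x x).
    by rewrite /d mE; ring.
  by rewrite /s; field; rewrite gt_eqF.
have ip : inner_product (metric_line T).
  apply: semidef_nondegenerate_pos => // [|x xw].
    exact: (metric_line_symmetric _ s10).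
  have J2 := herm_sqr h0.
  (* A vector [x] in the kernel of the limit metric gives a kernel vector [- J x] of [flow_map T],
     hence a root of [D] at [T]. *)
  have Mx : flow_map T (- J x) = 0.
    case: h0 => -[_ wn] _ _ _ _; apply: wn => y.
    by rewrite -[RHS](xw y) metric_lineE.
  apply/eqP; apply: contraT => x0; move: DT; apply: contraNT => _.
  apply/flow_poly_eq0; exists (- J x) => //.
  apply: contraNneq x0 => /(congr1 J); rewrite linearN /= J2 opprK linear0 => ->.
  exact: eqxx.
pose h : {biscalar V} := form_comp (form_comp w0 P0) (- J).
have hE x : h x x = p (- J x) x.
  by rewrite hP0 [LHS]/(w0 (P0 ((- J)%VF x)) x) lfunE.
have [C C0 hC] := form_bounded_by_metric h ip.
have C1 : 0 < 2 * (C + 1) by rewrite mulr_gt0 // ltr_wpDl.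
(* Within this radius [2 |t - T| C < 1], so the change of the metric from [T] to [t] is smaller than
   its value at [T]; [C + 1] covers the case [C = 0]. *)
exists (2 * (C + 1))^-1; first by rewrite invr_gt0.
move=> t tT; apply: (hermitian_line s10 h1) => x x0.
have Gp := ip.2 x x0; have := hC x.
rewrite hE.
have -> : metric_line t x x = metric_line T x x - 2 * (t - T) * p (- J x) x.
  by rewrite !mE; ring.
move=> pC; rewrite subr_gt0; apply: le_lt_trans (ler_norm _) _.
rewrite !normrM ger0_norm //.
have Ct : 2 * `|t - T| * C < 1.
  move: tT; rewrite -[X in _ < X]mul1r ltr_pdivlMr // => tT.
  have := normr_ge0 (t - T); move=> ?; nra.
apply: (@le_lt_trans _ _ (2 * `|t - T| * (C * metric_line T x x))).
  by rewrite ler_wpM2l // mulr_ge0.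
by rewrite mulrA gtr_pMl.
Qed.

End ChernRicciLine.

(** * The flow as a line, and its maximal interval *)

Lemma ereal_itv_scale (R : realType) (a b : \bar R) (s t : R) :
  (a < 0)%E -> (0 < b)%E -> 0 <= s <= 1 -> (a < t%:E < b)%E ->
  (a < (s * t)%:E < b)%E.
Proof.
move=> a0 b0 /andP[s0 s1] /andP[at_ tb].
have [t0|/ltW t0] := leP 0 t.
  rewrite (lt_le_trans a0) ?lee_fin ?mulr_ge0 //=.
  by rewrite (le_lt_trans _ tb) // lee_fin ler_piMl.
rewrite (lt_le_trans at_) ?lee_fin ?ler_niMl //=.
by rewrite (le_lt_trans _ b0) // lee_fin mulr_ge0_le0.
Qed.

(** The intermediate value theorem on [[0, 1]] for [s |-> - p(s t)]: the parameter [s] treats both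
    signs of [t], and the minus sign makes the sign change go upwards. *)
Lemma poly_gt0_segment (R : realType) (p : {poly R}) (t : R) : 0 < p.[0] ->
  (forall s, 0 <= s <= 1 -> p.[s * t] != 0) -> 0 < p.[t].
Proof.
move=> p0 pn0; rewrite ltNge; apply/negP => pt.
have qE s : (- (p \Po (t *: 'X))).[s] = - p.[s * t].
  by rewrite hornerN horner_comp hornerZ hornerX mulrC.
have [||s s01] := @poly_ivt R (- (p \Po (t *: 'X))) 0 1; first exact: ler01.
  by rewrite !qE mul0r mul1r oppr_le0 oppr_ge0 ltW.
by rewrite /root qE oppr_eq0 (negPf (pn0 s s01)).
Qed.

(** Uniqueness for the flow: its right-hand side is constant in time, so the difference from the
    line has derivative zero and vanishes at [0]. The metric is then recovered from the form and
    [J]. *)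
Lemma chern_ricci_flow_line (R : realType) (V : vectType R)
    (br : {bilinear V -> V -> V}) (J : 'End(V)) (w0 g0 : {biscalar V})
    (a b : \bar R) (w g : R -> {biscalar V}) (P0 : 'End(V)) :
  chern_ricci_operator br J w0 P0 -> chern_ricci_flow br J w0 g0 a b w g ->
  forall t : R, (a < t%:E < b)%E ->
    w t =2 form_line w0 P0 t /\ g t =2 metric_line J w0 P0 t.
Proof.
move=> hP0 [a0 b0 wz _ herm flow] t tab.
have wE : w t =2 form_line w0 P0 t.
  move=> x y; pose f (s : R) := w s x y - form_line w0 P0 s x y.
  have df s : 0 <= s <= 1 -> is_derive (s * t) 1 f 0.
    move=> s01; have sab := ereal_itv_scale a0 b0 s01 tab.
    have := is_deriveB (flow _ x y sab) (is_derive_form_line hP0 (s * t) x y).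
    by rewrite subrr.
  have f0 : f 0 = 0 by rewrite /f wz (form_lineE hP0) mul0r addr0 subrr.
  apply/eqP; rewrite -subr_eq0 -/(f t); apply/eqP.
  have df' r : 0 <= r / t <= 1 -> t != 0 -> is_derive r 1 f 0.
    by move=> rt t0; rewrite -(divfK t0 r); exact: df.
  have [t0|t0|t0] := ltgtP 0 t; last by rewrite -t0.
    apply: etrans f0; apply/esym/is_derive0_segment => [|r /andP[r0 rt]].
      exact: ltW.
    apply: df'; last by rewrite gt_eqF.
    by rewrite divr_ge0 ?(ltW t0) //= ler_pdivrMr // mul1r.
  apply: etrans f0; apply: is_derive0_segment => [|r /andP[rt r0]].
    exact: ltW.
  apply: df'; last by rewrite lt_eqF.
  by rewrite mulr_le0 ?invr_le0 ?(ltW t0) //= ler_ndivrMr // mul1r.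
split=> // x y.
by rewrite (hermitian_metricE _ _ (herm t tab)) wE metric_lineE.
Qed.

(** As long as the line is hermitian it is itself a solution, and it agrees with the given one on
    [(a, b)]; maximality therefore applies to it. *)
Lemma maximal_flow_line (R : realType) (V : vectType R)
    (br : {bilinear V -> V -> V}) (J : 'End(V)) (w0 g0 : {biscalar V})
    (a b : \bar R) (w g : R -> {biscalar V}) (P0 : 'End(V)) (a' b' : \bar R) :
  hermitian_structure br J w0 g0 -> chern_ricci_operator br J w0 P0 ->
  maximal_chern_ricci_flow br J w0 g0 a b w g ->
  (a' <= a)%E -> (b <= b')%E ->
  (forall t : R, (a' < t%:E < b')%E ->
    hermitian_structure br J (form_line w0 P0 t) (metric_line J w0 P0 t)) ->
  a' = a /\ b' = b.
Proof.
move=> h0 hP0 [fl mx] aa bb hl.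
apply: (mx a' b' (form_line w0 P0) (metric_line J w0 P0)) => //.
  split.
  - exact: le_lt_trans aa (crf_left fl).
  - exact: lt_le_trans (crf_right fl) bb.
  - by move=> x y; rewrite (form_lineE hP0) mul0r addr0.
  - move=> x y; rewrite metric_lineE (form_lineE hP0) mul0r addr0.
    by rewrite (hermitian_metricE _ _ h0).
  - exact: hl.
  - by move=> t x y _; exact: is_derive_form_line.
by move=> t /(chern_ricci_flow_line hP0 fl)[wE gE]; split=> x y; rewrite ?wE ?gE.
Qed.

(** * Divergence and blow-up rate at the finite ends *)

Theorem mainTheorem10 (R : realType) (n : nat) (V : vectType R)
    (hdim : \dim {:V} = (2 * n)%N)
    (br : {bilinear V -> V -> V}) (hbr : lie_bracket br)
    (J : 'End(V)) (w0 g0 : {biscalar V})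
    (h0 : hermitian_structure br J w0 g0)
    (Tm Tp : \bar R) (w g : R -> {biscalar V})
    (hflow : maximal_chern_ricci_flow br J w0 g0 Tm Tp w g)
    (P : R -> 'End(V))
    (hP : forall t : R, (Tm < t%:E < Tp)%E ->
       chern_ricci_operator br J (w t) (P t)) :
  [/\ (Tp < +oo)%E ->
        has_integral `[0, fine Tp[ (fun t => end_tr (P t)) +oo%E,
      (-oo < Tm)%E ->
        has_integral `]fine Tm, 0] (fun t => end_tr (P t)) -oo%E
    & (Tp < +oo)%E ->
        exists2 C : R, 0 < C &
          forall t : R, 0 <= t < fine Tp ->
            end_tr (P t) <= C / (fine Tp - t)].
Proof.
have fl := hflow.1; have Tm0 := crf_left fl; have Tp0 := crf_right fl.
have hP0 : chern_ricci_operator br J w0 (P 0).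
  by move=> x y; rewrite -(crf_form0 fl) -hP // Tm0.
pose D := flow_poly (P 0).
have lineE := chern_ricci_flow_line hP0 fl.
have hl t : (Tm < t%:E < Tp)%E ->
    hermitian_structure br J (form_line w0 (P 0) t) (metric_line J w0 (P 0) t).
  move=> tT; have [wE gE] := lineE t tT.
  exact: hermitian_eq2 wE gE (crf_hermitian fl tT).
have Dpos t : (Tm < t%:E < Tp)%E -> 0 < D.[t].
  move=> tT; apply: poly_gt0_segment => [|s s01]; first by rewrite flow_poly0.
  apply: flow_poly_neq0; apply: hl; exact: ereal_itv_scale tT.
have trE t : (Tm < t%:E < Tp)%E ->
    end_tr (P t) = - 2^-1 * (D^`().[t] / D.[t]).
  move=> tT; have [wE gE] := lineE t tT.
  apply: (chern_scalar_logderiv h0 hP0 _ wE (hP t tT)).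
  by apply: hermitian_eq2 (crf_hermitian fl tT).
have right : (Tp < +oo)%E ->
    has_integral `[0, fine Tp[ (fun t => end_tr (P t)) +oo%E /\
    exists2 C : R, 0 < C & forall t : R, 0 <= t < fine Tp ->
      end_tr (P t) <= C / (fine Tp - t).
  case: Tp Tp0 {fl} hflow hP lineE hl Dpos trE =>
    [T| |] // T0 hflow _ _ hl Dpos trE _.
  rewrite lte_fin in T0; rewrite /=.
  have inT t : 0 <= t < T -> (Tm < t%:E < T%:E)%E.
    by move=> /andP[t0 tT]; rewrite lte_fin tT (lt_le_trans Tm0).
  apply: (@logderiv_blowup_right R D) => //; last 2 first.
  - by move=> t /inT/Dpos.
  - by move=> t /inT/trE.
  (* Were [D.[T]] nonzero, the line would stay hermitian up to [T + e], against maximality. *)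
  apply/eqP; apply: contraT => DT.
  have [||e e0 he] := hermitian_near_endpoint h0 hP0 _ _ DT.
  - by rewrite gt_eqF.
  - move=> s /andP[s0 s1]; apply/hl/inT.
    by rewrite mulr_ge0 ?(ltW T0) //= gtr_pMl.
  have [|||_ /eqP] :=
    maximal_flow_line (a' := Tm) (b' := (T + e)%:E) h0 hP0 hflow.
  - exact: lexx.
  - by rewrite lee_fin lerDl ltW.
  - move=> t /andP[mt tT]; have [lt|ge] := ltP t T.
      by apply: hl; rewrite mt lte_fin.
    apply: he; rewrite ger0_norm ?subr_ge0 // ltrBlDl.
    by rewrite -lte_fin.
  by rewrite eqe gt_eqF // ltrDl.
split; [by move/right => -[]| |by move/right => -[]].
case: Tm Tm0 {fl right} hflow hP lineE hl Dpos trE =>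
  [T| |] // T0 hflow _ _ hl Dpos trE _.
rewrite lte_fin in T0; rewrite /=.
have inT t : T < t <= 0 -> (T%:E < t%:E < Tp)%E.
  by move=> /andP[Tt t0]; rewrite lte_fin Tt (le_lt_trans _ Tp0).
apply: (@logderiv_blowup_left R D) => //; last 2 first.
- by move=> t /inT/Dpos.
- by move=> t /inT/trE.
(* Likewise, a nonzero [D.[T]] would extend the flow down to [T - e]. *)
apply/eqP; apply: contraT => DT.
have [||e e0 he] := hermitian_near_endpoint h0 hP0 _ _ DT.
- by rewrite lt_eqF.
- move=> s /andP[s0 s1]; apply/hl/inT.
  by rewrite mulr_ge0_le0 ?(ltW T0) //= andbT; nra.
have [|||/eqP + _] :=
  maximal_flow_line (a' := (T - e)%:E) (b' := Tp) h0 hP0 hflow.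
- by rewrite lee_fin gerBl ltW.
- exact: lexx.
- move=> t /andP[mt tT]; have [lt|ge] := ltP T t.
    by apply: hl; rewrite tT lte_fin lt.
  apply: he; rewrite ler0_norm ?subr_le0 // opprB ltrBlDr -ltrBlDl.
  by rewrite -lte_fin.
by rewrite eqe lt_eqF // gtrBl.
Qed.
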